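(* Let $X$ be a compact geodesic space and $\varepsilon>0$. Then the number $NC(\varepsilon)$ of equivalence classes of entourage covers $\phi_E:X_E\to X$ (with $E$ a chained entourage in $X$) such that $\sigma(E)\ge\varepsilon$ is at most $$2^{\,C(X,\frac{\varepsilon}{4})^{40\,C(X,\frac{\varepsilon}{2})}}.$$
   Context: A geodesic space is a metric space $(X,d)$ in which any two points $x,y$ are joined by a curve of length $d(x,y)$. $C(X,r)$ denotes the (minimal) number of open $r$-balls needed to cover $X$. An entourage in a metric space $X$ is a symmetric subset $E\subset X\times X$ containing $E_\varepsilon:=\{(x,y):d(x,y)<\varepsilon\}$ for some $\varepsilon>0$. $B(x,E):=\{y:(x,y)\in E\}$. An $E$-chain is a finite sequence $\{x_0,\dots,x_n\}$ with $(x_i,x_{i+1})\in E$ for all $i$. An $E$-homotopy between $E$-chains is a finite sequence of $E$-chains with the same endpoints, each obtained from the previous one by inserting or removing a single point (never an endpoint), every step remaining an $E$-chain; $[\alpha]_E$ is the $E$-homotopy class of $\alpha$ (a chain $\{x,x\}$ is identified with $\{x\}$). Concatenation is $\ast$, reversal is $\overline{\alpha}$. $E$ is chained if $E$ is contained in the closure of its interior and whenever $(x,y)\in E$ and $F$ is an entourage, $x,y$ can be joined by an $F$-chain lying in $B(x,E)\cap B(y,E)$. Fix a basepoint $\ast\in X$. $X_E$ is the set of classes $[\alpha]_E$ of $E$-chains starting at $\ast$, and $\phi_E:X_E\to X$ sends $[\alpha]_E$ to the endpoint of $\alpha$. For an entourage $F\subset E$, $F^\ast$ is the set of pairs $([\alpha]_E,[\beta]_E)$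 with endpoints $x,y$ such that $(x,y)\in F$ and $[\overline{\alpha}\ast\beta]_E=[\{x,y\}]_E$; the balls $B(\cdot,F^\ast)$ form a basis of the topology of $X_E$, for which $\phi_E$ is a regular covering map. An entourage cover (or $E$-cover) is a $\phi_E$ with $E$ chained. Two covers of $X$ are equivalent if there is a homeomorphism between the total spaces commuting with the projections to $X$. $\sigma(E):=\sup\{\varepsilon>0:E_\varepsilon\subset E\}$. *)

(* Defs.v *)
From HB Require Import structures.
From Stdlib Require Import Relation_Operators Operators_Properties.
From mathcomp Require Import all_boot all_order all_algebra generic_quotient.
From mathcomp Require Import all_classical all_reals all_analysis.

Set Implicit Arguments.
Unset Strict Implicit.
Unset Printing Implicit Defensive.

Import Order.TTheory GRing.Theory Num.Theory.
Import numFieldNormedType.Exports.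

Local Open Scope classical_set_scope.
Local Open Scope ring_scope.
Local Open Scope quotient_scope.

Section MetricNotions.
Context {R : realType} {X : metricType R}.

Definition curve_length (g : R -> X) (a b : R) : \bar R :=
  ereal_sup [set (\sum_(i < size s)
                    mdist (g (nth b (a :: s) i)) (g (nth b (a :: s) i.+1)))%:E
            | s in itv_partition a b].

Definition geodesic_space : Prop :=
  forall x y : X, exists g : R -> X,
    [/\ {within `[0, 1], continuous g}, g 0 = x, g 1 = y
      & curve_length g 0 1 = (mdist x y)%:E].

Definition ball_cover (r : R) (s : seq X) : Prop :=
  forall x, exists2 c, c \in s & ball c r x.

(* The value is 0 by convention when no finite family of r-balls covers X;
   this does not happen when X is compact and r > 0. *)
Definition covering_number (r : R) : nat :=
  xget 0%N [set n | (exists2 s, size s = n & ball_cover r s) /\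
                    (forall s, ball_cover r s -> (n <= size s)%N)].

Definition eps_entourage (e : R) : set (X * X) :=
  [set xy | mdist xy.1 xy.2 < e].

Definition is_entourage (E : set (X * X)) : Prop :=
  (forall x y, E (x, y) -> E (y, x)) /\
  (exists2 e, 0 < e & eps_entourage e `<=` E).

Definition eball (x : X) (E : set (X * X)) : set X := [set y | E (x, y)].

(* The chain {x_0, ..., x_n} is the nonempty list [:: x_0; ...; x_n]. *)
Definition is_chain (E : set (X * X)) (s : seq X) : Prop :=
  s != [::] /\ sorted (fun x y => (x, y) \in E) s.

Definition chained (E : set (X * X)) : Prop :=
  E `<=` closure (E°) /\
  (forall x y, E (x, y) -> forall F, is_entourage F ->
     exists s, [/\ is_chain F (x :: s), last x s = y
       & forall z, z \in x :: s -> (eball x E `&` eball y E) z]).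

(* Extended-real valued: the set of such e may be unbounded, e.g. when
   E = setT. *)
Definition sigma (E : set (X * X)) : \bar R :=
  ereal_sup [set e%:E | e in [set e : R | 0 < e /\ eps_entourage e `<=` E]].

(* Inserting a point between two consecutive points; an endpoint is never
   inserted or removed.  The second constructor is the convention
   {x, x} = {x}. *)
Inductive homotopy_step (E : set (X * X)) : seq X -> seq X -> Prop :=
| homotopy_insert s1 x z y s2 :
    is_chain E (s1 ++ [:: x, y & s2]) -> is_chain E (s1 ++ [:: x, z, y & s2]) ->
    homotopy_step E (s1 ++ [:: x, y & s2]) (s1 ++ [:: x, z, y & s2])
| homotopy_trivial x : homotopy_step E [:: x] [:: x; x].

Definition homotopic (E : set (X * X)) : seq X -> seq X -> Prop :=
  clos_refl_sym_trans (seq X) (homotopy_step E).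

Definition concat_chain (s t : seq X) : seq X := s ++ behead t.

End MetricNotions.

Arguments geodesic_space {R} X.
Arguments covering_number {R} X r.

Record entourage_of (R : realType) (X : metricType R) := EntourageOf {
  entourage_set :> set (X * X);
  entourage_setP : is_entourage entourage_set }.

Section EntourageCover.
Context {R : realType} {X : metricType R} (x0 : X) (E : entourage_of X).

Definition based_chain : pred (seq X) :=
  fun s => `[< is_chain E s /\ head x0 s = x0 >].

Definition based_chains : Type := {s : seq X | based_chain s}.
HB.instance Definition _ := Choice.on based_chains.

Definition chain_end (s : based_chains) : X := last x0 (val s).

Definition homotopic_rel : rel based_chains :=
  fun s t => `[< homotopic E (val s) (val t) >].

Lemma homotopic_rel_refl : reflexive homotopic_rel.
Proof. by move=> s; apply/asboolP; exact: rst_refl. Qed.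

Lemma homotopic_rel_sym : symmetric homotopic_rel.
Proof.
by move=> s t; apply/asboolP/asboolP => ?; exact: rst_sym.
Qed.

Lemma homotopic_rel_trans : transitive homotopic_rel.
Proof.
move=> t s u /asboolP st /asboolP tu; apply/asboolP; exact: rst_trans st tu.
Qed.

Canonical homotopic_equiv :=
  EquivRel homotopic_rel homotopic_rel_refl homotopic_rel_sym
           homotopic_rel_trans.

Definition cover_space : Type := {eq_quot homotopic_equiv}.
HB.instance Definition _ := Choice.on cover_space.
HB.instance Definition _ := EqQuotient.on cover_space.

Definition cover_map (p : cover_space) : X := chain_end (repr p).

Lemma homotopic_last (s t : seq X) :
  homotopic E s t -> last x0 s = last x0 t.
Proof.
elim=> [_ _ [s1 x z y s2 _ _|//]|//|s' t' _ ->//|s' t' u _ -> _ ->//].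
by rewrite !last_cat.
Qed.

Lemma cover_map_pi (s : based_chains) :
  cover_map (\pi_cover_space s) = chain_end s.
Proof.
have /eqmodP/asboolP/homotopic_last : repr (\pi_cover_space s) = s
  %[mod {eq_quot homotopic_equiv}] by rewrite reprK.
exact.
Qed.

Definition star (F : set (X * X)) : set (cover_space * cover_space) :=
  [set pq | exists a b : based_chains,
    [/\ pq.1 = \pi_cover_space a, pq.2 = \pi_cover_space b,
        F (chain_end a, chain_end b)
      & homotopic E (concat_chain (rev (val a)) (val b))
                    [:: chain_end a; chain_end b]]].

Definition star_ball (F : set (X * X)) (p : cover_space) : set cover_space :=
  [set q | star F (p, q)].

(* Since F need not be open, the balls B(p, F* ) form a basis of
   neighbourhoods, not a basis of open sets. *)
Definition cover_open (U : set cover_space) : Prop :=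
  forall p, U p -> exists F : set (X * X),
    [/\ is_entourage F, F `<=` E & star_ball F p `<=` U].

Lemma star_subset (F G : set (X * X)) (p : cover_space) :
  F `<=` G -> star_ball F p `<=` star_ball G p.
Proof.
by move=> FG q [a [b [/= -> -> Fab hab]]]; exists a, b; split=> //; exact: FG.
Qed.

Lemma cover_openT : cover_open setT.
Proof. by move=> p _; exists E; split=> //; exact: entourage_setP. Qed.

Lemma is_entourageI (F G : set (X * X)) :
  is_entourage F -> is_entourage G -> is_entourage (F `&` G).
Proof.
move=> [Fs [e e0 eF]] [Gs [d d0 dG]]; split.
  by move=> x y [Fxy Gxy]; split; [exact: Fs|exact: Gs].
exists (Num.min e d); first by rewrite lt_min e0.
move=> xy; rewrite /eps_entourage/= lt_min => /andP[xye xyd].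
by split; [exact: eF|exact: dG].
Qed.

Lemma cover_openI : setI_closed cover_open.
Proof.
move=> U V oU oV p [/oU[F [eF FE FU]] /oV[G [eG GE GV]]].
exists (F `&` G); split; first exact: is_entourageI.
- by move=> xy [/FE].
- move=> q pq; split; [apply: FU|apply: GV]; apply: star_subset pq;
    by move=> xy [].
Qed.

Lemma cover_open_bigcup (I : Type) (f : I -> set cover_space) :
  (forall i, cover_open (f i)) -> cover_open (\bigcup_i f i).
Proof.
move=> of_ p [i _ /of_[F [eF FE Fi]]]; exists F; split=> //.
by move=> q /Fi fq; exists i.
Qed.

HB.instance Definition _ := isOpenTopological.Build cover_space
  cover_openT cover_openI cover_open_bigcup.

Lemma cover_openE (U : set cover_space) : open U = cover_open U.
Proof. by []. Qed.

End EntourageCover.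

Section Classification.
Context {R : realType} {X : metricType R} (x0 : X).

Definition equivalent_covers (E F : entourage_of X) : Prop :=
  exists (h : cover_space x0 E -> cover_space x0 F)
         (k : cover_space x0 F -> cover_space x0 E),
    [/\ cancel h k, cancel k h, continuous h, continuous k
      & forall p, cover_map (h p) = cover_map p].

Definition cover_class (E : entourage_of X) : set (entourage_of X) :=
  [set F : entourage_of X | chained F /\ equivalent_covers E F].

(* A cover phi_E is represented by the entourage E indexing it, so an
   equivalence class of covers is a set of chained entourages. *)
Definition cover_classes (e : R) : set (set (entourage_of X)) :=
  [set cover_class E
  | E in [set E : entourage_of X | chained E /\ (e%:E <= sigma E)%E]].

End Classification.

(* Main.v *)
Require Import Defs.
From mathcomp Require Import all_boot all_order all_algebra.
From mathcomp Require Import all_classical all_reals all_analysis.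
From Stdlib Require Import Relation_Operators.
From mathcomp Require Import generic_quotient lra zify.

(* Write C and N for the covering numbers at eps / 2 and eps / 4.  If E is
   chained and contains the eps-entourage, then any (x, y) in E is joined by an
   eps-chain in B(x, E) and B(y, E); a shortest one meets each (eps / 2)-ball in
   at most two points, so it has at most 2 C steps, and it is E-homotopic to
   {x, y}.  Replacing each E-step by such a filling turns E-chains into
   eps-chains, and the insertion of a point into an E-chain becomes an E-null
   eps-loop of at most 6 C steps.  Inserting midpoints and moving every point to
   an (eps / 4)-net turns it into a loop of at most 12 C + 1 net points that is
   null for exactly the same entourages.  Hence the set of E-null words of
   length 40 C over the net determines which eps-chains are E-homotopic.  If it
   is the same for E and F, sending the class of a chain to the class of its
   refinement is a homeomorphism from X_E to X_F over X. *)

Set Implicit Arguments.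
Unset Strict Implicit.
Unset Printing Implicit Defensive.

Import Order.TTheory GRing.Theory Num.Theory.
Import numFieldNormedType.Exports.

Local Open Scope classical_set_scope.
Local Open Scope ring_scope.
Local Open Scope card_scope.

(** * Chain homotopy: congruence, reversal and null loops *)

Section ChainHomotopy.
Context {R : realType} {X : metricType R}.
Implicit Types (E : set (X * X)) (x y z : X) (s t u v : seq X).

Definition erel E : rel X := fun x y => (x, y) \in E.

(** The reversal of [x :: s] without its head [last x s]: chains are handled throughout as a head
    and a tail. *)
Definition rtail x s := rev (belast x s).

Lemma is_chainE E x s : is_chain E (x :: s) <-> path (erel E) x s.
Proof. by split=> [[]//|]; split. Qed.

Lemma is_chain_cat E u x v :
  is_chain E (u ++ x :: v) <->
  sorted (erel E) (rcons u x) /\ path (erel E) x v.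
Proof.
case: u => [|a u].
  by split=> [[]//|[] //].
suff -> : is_chain E ((a :: u) ++ x :: v) <-> path (erel E) a (u ++ x :: v).
  by rewrite /= rcons_path cat_path /= andbA; split=> [/andP[]|[-> ->]].
exact: is_chainE.
Qed.

Lemma last_rtail x s : last (last x s) (rtail x s) = x.
Proof. by case: s => //= y s; rewrite /rtail /= rev_cons last_rcons. Qed.

Lemma size_rtail x s : size (rtail x s) = size s.
Proof. by rewrite size_rev size_belast. Qed.

Lemma rev_rtail x s : rev (x :: s) = last x s :: rtail x s.
Proof. by rewrite lastI rev_rcons. Qed.

Lemma rtailK x s : rtail (last x s) (rtail x s) = s.
Proof.
have := revK (x :: s); rewrite rev_rtail rev_rtail last_rtail.
by case.
Qed.

Lemma rtail_rcons x s z : rtail x (rcons s z) = last x s :: rtail x s.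
Proof. by rewrite /rtail belast_rcons rev_rtail. Qed.

Lemma path_rtail E x s : (forall x y, E (x, y) -> E (y, x)) ->
  path (erel E) x s -> path (erel E) (last x s) (rtail x s).
Proof.
move=> Esym; rewrite rev_path; apply: sub_path => y z.
by rewrite /erel !inE; exact: Esym.
Qed.

Section Reflexive.
Variable E : set (X * X).
Hypothesis Erefl : forall x, E (x, x).

Let errefl x : erel E x x. Proof. exact/mem_set. Qed.

Lemma homotopic_insert u x z y v :
  erel E x y -> erel E x z -> erel E z y ->
  is_chain E (u ++ [:: x, y & v]) ->
  homotopic E (u ++ [:: x, y & v]) (u ++ [:: x, z, y & v]).
Proof.
move=> xy xz zy c; apply: rst_step; constructor => //.
by move: c; rewrite !is_chain_cat /= xy xz zy.
Qed.

(** If [x] has a neighbour in the chain, the copy of [x] is inserted between the two; only the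
    one-point chain needs the convention that identifies {x, x} with {x}. *)
Lemma homotopic_stutter u x v : is_chain E (u ++ x :: v) ->
  homotopic E (u ++ x :: v) (u ++ [:: x, x & v]).
Proof.
case: v => [|y v]; last first.
  move=> c; apply: homotopic_insert => //; move: c;
    by rewrite is_chain_cat /= => -[_ /andP[]].
case/lastP: u => [_|u a]; first by apply: rst_step; exact: homotopy_trivial.
rewrite !cat_rcons => c; apply: homotopic_insert => //; move: c;
  by rewrite is_chain_cat /= => -[_ /andP[]].
Qed.

(** The chain condition is carried along with the homotopy because the symmetric and transitive
    cases of the induction must know that the intermediate lists are chains. *)
Let congruent s t := forall u v,
  (is_chain E (u ++ s ++ v) <-> is_chain E (u ++ t ++ v)) /\
  (is_chain E (u ++ s ++ v) -> homotopic E (u ++ s ++ v) (u ++ t ++ v)).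

Let homotopic_congruent s t : homotopic E s t -> congruent s t.
Proof.
elim=> {s t} [_ _ [s x z y t + +|x]|s|s t _ st|s t w _ st _ tw] u v.
- rewrite !is_chain_cat /=.
  move=> [_ /andP[xy _]] [_ /and3P[xz zy _]].
  rewrite -!catA /= !(catA u) !is_chain_cat /= xy xz zy; split=> // c.
  by apply: homotopic_insert => //; rewrite is_chain_cat /= xy.
- rewrite /= !is_chain_cat /= errefl; split=> // c.
  by apply: homotopic_stutter; rewrite is_chain_cat.
- by split=> // _; exact: rst_refl.
- have [st1 st2] := st u v; split; first by rewrite st1.
  by move=> /st1/st2; exact: rst_sym.
- have [st1 st2] := st u v; have [tw1 tw2] := tw u v.
  split; first by rewrite st1.
  by move=> c; apply: rst_trans (st2 c) (tw2 _); exact/st1.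
Qed.

Lemma homotopic_chain s t : homotopic E s t -> is_chain E s <-> is_chain E t.
Proof. by move=> /homotopic_congruent/(_ [::] [::])[]; rewrite /= !cats0. Qed.

Lemma homotopic_cat u v s t : homotopic E s t ->
  is_chain E (u ++ s ++ v) -> homotopic E (u ++ s ++ v) (u ++ t ++ v).
Proof. by move=> /homotopic_congruent/(_ u v)[]. Qed.

Lemma homotopic_path x s t : homotopic E (x :: s) (x :: t) ->
  path (erel E) x s = path (erel E) x t.
Proof.
by move=> /homotopic_chain; rewrite !is_chainE => st; apply/idP/idP => /st.
Qed.

Lemma homotopic_catl x u s t : path (erel E) x (u ++ s) ->
  homotopic E (last x u :: s) (last x u :: t) ->
  homotopic E (x :: u ++ s) (x :: u ++ t).
Proof.
move=> c /(@homotopic_cat (belast x u) [::] _ _).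
rewrite !cats0 -!cat_rcons -!lastI; apply; exact/is_chainE.
Qed.

Lemma homotopic_catr x s t v : path (erel E) x (s ++ v) ->
  homotopic E (x :: s) (x :: t) ->
  homotopic E (x :: s ++ v) (x :: t ++ v).
Proof. by move=> c /(@homotopic_cat [::] v _ _); apply; exact/is_chainE. Qed.

Lemma homotopic_spur x z s : erel E x z -> erel E z x ->
  path (erel E) x s -> homotopic E [:: x, z, x & s] (x :: s).
Proof.
move=> xz zx c; apply: (@rst_trans _ _ _ [:: x, x & s]).
  apply: rst_sym; apply: (@homotopic_insert [::]) => //.
  by apply/is_chainE => /=; rewrite errefl.
by apply: rst_sym; apply: (@homotopic_stutter [::]); exact/is_chainE.
Qed.

Hypothesis Esym : forall x y, E (x, y) -> E (y, x).

Let ersym x y : erel E x y -> erel E y x.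
Proof. by rewrite /erel !inE; exact: Esym. Qed.

(** A path followed by its reversal cancels from the turning point: the last point of [s] is the tip
    of a spur, which is removed, and induction applies to what is left. *)
Lemma homotopic_cat_rtail x s t : path (erel E) x s ->
  path (erel E) x t ->
  homotopic E (x :: s ++ rtail x s ++ t) (x :: t).
Proof.
elim/last_ind: s => [_ _|s z IH]; first exact: rst_refl.
rewrite rcons_path => /andP[cs lz] ct; rewrite rtail_rcons /=.
apply: (rst_trans _ _ _ _ _ _ (IH cs ct)).
have crt : path (erel E) (last x s) (rtail x s ++ t).
  by rewrite cat_path path_rtail //= last_rtail.
rewrite cat_rcons; apply: homotopic_catl; last first.
  by apply: homotopic_spur => //; exact: ersym.
by rewrite cat_path cs /= lz ersym.
Qed.

(** Forward, append [t] to the null loop and cancel the reversal of [t] against [t]; backward,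
    replace [s] by [t] and cancel. *)
Lemma homotopic_nullP x s t : path (erel E) x s -> path (erel E) x t ->
  last x s = last x t ->
  homotopic E (x :: s ++ rtail x t) [:: x] <-> homotopic E (x :: s) (x :: t).
Proof.
move=> cs ct st; have crt := path_rtail Esym ct.
have cst : path (erel E) x (s ++ rtail x t) by rewrite cat_path cs st.
split=> [h|h].
  have c : path (erel E) x ((s ++ rtail x t) ++ t).
    by rewrite cat_path cst last_cat st last_rtail.
  apply: (rst_trans _ _ _ _ _ _ (homotopic_catr c h)).
  rewrite -catA; apply: rst_sym; rewrite -{2}[s]cats0.
  have crt0 : path (erel E) (last x s) (rtail x t ++ t).
    by rewrite cat_path st crt last_rtail.
  apply: homotopic_catl; first by rewrite cat_path cs.
  rewrite st in crt0 *.
  have := @homotopic_cat_rtail (last x t) (rtail x t) [::] crt isT.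
  by rewrite rtailK cats0.
apply: (rst_trans _ _ _ _ _ (homotopic_catr cst h)).
by have := @homotopic_cat_rtail x t [::] ct isT; rewrite cats0.
Qed.

End Reflexive.
End ChainHomotopy.

(** * Covering numbers, midpoints and short chains *)

Section MetricGeometry.
Context {R : realType} {X : metricType R}.
Implicit Types (E : set (X * X)) (x y z : X) (s t u v : seq X).

(** If no finite family of balls covered, the complements of finite unions of balls would generate a
    proper filter; its cluster point [p] is contradicted by the ball around [p]. So the default
    value 0 is not what is being read. *)
Lemma covering_numberP (r : R) : compact [set: X] -> 0 < r ->
  exists2 s : seq X, size s = covering_number X r & ball_cover r s.
Proof.
move=> cX r0.
have covs : exists n, `[< exists2 s : seq X, size s = n & ball_cover r s >].
  apply: contrapT => nocov.
  pose F := filter_from setT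
    (fun s : seq X => [set x | forall c, c \in s -> ~ ball c r x]).
  have FF : ProperFilter F.
    apply: filter_from_proper => [|s _].
      apply: filter_from_filter => [|s t _ _]; first by exists [::].
      exists (s ++ t) => // x xst; split=> c cs; apply: xst.
        by rewrite mem_cat cs.
      by rewrite mem_cat cs orbT.
    apply: contrapT => s0; apply: nocov.
    exists (size s); apply/asboolP; exists s => // x.
    apply: contrapT => xs; apply: s0; exists x.
    by move=> c cs cx; apply: xs; exists c.
  have [|p [_ Fp]] := cX F FF; first by exists [::].
  have [||q [/(_ p)]] := Fp [set x | forall c, c \in [:: p] -> ~ ball c r x]
    (ball p r).
  - by exists [:: p].
  - exact: nbhsx_ballx.
  - by rewrite inE eqxx => /(_ isT).
suff : [set n | (exists2 s : seq X, size s = n & ball_cover r s) /\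
    (forall s : seq X, ball_cover r s -> (n <= size s)%N)]
  (covering_number X r).
  by case.
apply: xgetPex; have [n /asboolP nP nmin] := ex_minnP covs.
by exists n; split=> // s sr; apply: nmin; apply/asboolP; exists s.
Qed.

Lemma is_entourage_eps (e : R) : 0 < e -> is_entourage (@eps_entourage R X e).
Proof.
move=> e0; split; last by exists e.
by move=> x y; rewrite /eps_entourage /= metric_sym.
Qed.

(** The intermediate value theorem gives a point of the geodesic at half the distance from [x]; the
    length of the curve, tested on a partition through that point, bounds its distance to [y]. *)
Lemma geodesic_midpoint x y : geodesic_space X ->
  exists m, mdist x m <= mdist x y / 2 /\ mdist m y <= mdist x y / 2.
Proof.
move=> /(_ x y)[g [gc g0 g1 gl]].
have xy0 := mdist_ge0 x y.
have dc : {within `[0, 1], continuous (fun r : R => mdist x (g r) : R)}.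
  move=> r; apply/cvgrPdist_lt => e e0.
  have := @metricType_numDomainType.cvgr_dist_lt _ _ _ _ _ _ _ (gc r) _ e0.
  move=> /(_ _); rewrite /from_subspace /=; apply: filterS => q.
  have := metric_triangle x (g r) (g q); have := metric_triangle x (g q) (g r).
  rewrite (metric_sym (g q)) ltr_norml.
  by move: (mdist x (g r)) (mdist x (g q)) (mdist (g r) (g q)) => *; lra.
have [|||r rI rm] := @IVT R (fun r : R => mdist x (g r)) 0 1 (mdist x y / 2).
- exact: ler01.
- exact: dc.
- rewrite g0 g1 mdistxx (min_idPl _) ?(max_idPr _) ?mdist_ge0 //.
  by apply/andP; lra.
exists (g r).
have := rI; rewrite in_itv /= => /andP[r0 r1].
(* Partitions are strictly increasing, so [r] must lie strictly between 0 and 1; at either end the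
   two points coincide. *)
have [r0'|r0'] := eqVneq r 0.
  by move: rm; rewrite r0' g0 mdistxx; lra.
have [r1'|r1'] := eqVneq r 1.
  by move: rm; rewrite r1' g1 mdistxx; lra.
have : (((mdist x (g r) + mdist (g r) y)%:E) <= (mdist x y)%:E)%E.
  rewrite -gl; apply: ereal_sup_ubound; exists [:: r; 1].
    by rewrite /itv_partition /= !lt_neqAle r0 r1 eqxx eq_sym r0' r1'.
  by rewrite /= !big_ord_recl big_ord0 /= g0 g1 addr0.
by rewrite lee_fin rm; lra.
Qed.

Lemma short_chain_in (e : R) (N : seq X) (A : set X) x y s :
  ball_cover (e / 2) N ->
  path (erel (eps_entourage e)) x s -> last x s = y ->
  (forall z, z \in x :: s -> A z) ->
  exists t, [/\ path (erel (eps_entourage e)) x t, last x t = y,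
    (forall z, z \in x :: t -> A z) & (size t < 2 * size N)%N ].
Proof.
move=> covN xs sy sA.
pose good t := [/\ path (erel (eps_entourage e)) x t, last x t = y
  & forall z, z \in x :: t -> A z].
have goods : exists n, `[< exists2 t, size t = n & good t >].
  by exists (size s); apply/asboolP; exists s.
have [n /asboolP[t tn [xt ty tA]] nmin] := ex_minnP goods.
exists t; split=> //.
pose p i := nth x (x :: t) i.
(* Otherwise jumping from [p i] to [p j] shortens the chain. Indices count from [x], hence the shift
   to [j.-1] in [t]. *)
have far i j : (i.+1 < j)%N -> (j <= size t)%N -> ~ mdist (p i) (p j) < e.
  move=> ij jt pij.
  have j0 : (j.-1 < size t)%N by lia.
  have pj : p j = nth x t j.-1 by rewrite /p -(ltn_predK ij).
  have dj : drop j.-1 t = p j :: drop j t.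
    by rewrite (drop_nth x j0) pj (ltn_predK ij).
  have li : last x (take i t) = p i.
    rewrite (last_nth x) size_take_min (minn_idPl _) /p; last by lia.
    by case: (i) => //= k; rewrite nth_take.
  have lj : last (p j) (drop j t) = y.
    by rewrite -ty -{2}(cat_take_drop j.-1 t) dj last_cat.
  suff : (n <= size (take i t ++ drop j.-1 t))%N.
    by rewrite size_cat size_take_min size_drop; lia.
  apply: nmin; apply/asboolP; exists (take i t ++ drop j.-1 t) => //; split.
  - rewrite cat_path take_path //= li dj /=; apply/andP; split.
      exact/mem_set.
    by move: xt; rewrite -{1}(cat_take_drop j.-1 t) dj cat_path /= => /and3P[].
  - by rewrite last_cat li dj /= lj.
  - move=> z; rewrite inE mem_cat => zt; apply: tA; rewrite inE.
    by case/orP: zt => [->//|/orP[/mem_take->|/mem_drop->]]; rewrite orbT.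
have /choice[c cP] : forall z,
    exists k : 'I_(size N), ball (nth z N k) (e / 2) z.
  move=> z; have [c cN cz] := covN z.
  have kN : (index c N < size N)%N by rewrite index_mem.
  by exists (Ordinal kN); rewrite /= nth_index.
(* Distinct indices of equal parity differ by at least two, so their points cannot share a ball of
   radius e / 2: pigeonhole on pairs (ball, parity). *)
pose f (i : 'I_(size t).+1) := (c (p i), odd i).
have finj : injective f.
  suff W (i j : 'I_(size t).+1) : (i < j)%N -> f i <> f j.
    move=> i j ij; apply/val_inj => /=.
    by case: (ltngtP i j) => // /W; rewrite ij.
  move=> ij [cij oij]; apply: (@far i j) => //.
  - by move: ij oij; rewrite leq_eqVlt => /orP[/eqP <- /=|//]; case: odd.
  - by rewrite -ltnS.
  - have := cP (p i); have := cP (p j).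
    rewrite -cij !ballEmdist /= (set_nth_default (p i)) //.
    move: (nth _ _ _) => b bj bi; have := metric_triangle (p i) b (p j).
    by rewrite (metric_sym (p i) b); lra.
have := leq_card f finj.
by rewrite card_prod !card_ord card_bool mulnC.
Qed.

End MetricGeometry.

(** * Refining chains by fillings *)

Section Refinement.
Context {R : realType} {X : metricType R}.
Implicit Types (E F : set (X * X)) (x y z : X) (s t u v : seq X).
Variables (e : R) (m : nat).
Hypothesis e_gt0 : 0 < e.
Let B : set (X * X) := eps_entourage e.

(* The last clause makes refinement the identity on eps-chains. *)
Definition is_filling E x y s : Prop :=
  [/\ path (erel B) x s, last x s = y, (size s <= m)%N,
      homotopic E (x :: s) [:: x; y] & mdist x y < e -> s = [:: y]].

Definition filling E x y : seq X := xget [::] [set s | is_filling E x y s].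

Fixpoint refine_tail E x s : seq X :=
  if s is y :: s' then filling E x y ++ refine_tail E y s' else [::].

Definition refine E s : seq X :=
  if s is x :: s' then x :: refine_tail E x s' else [::].

Definition fillable E : Prop :=
  forall x y, E (x, y) -> exists s, is_filling E x y s.

(** This is what is needed for an insertion into an [E]-chain to become an [F]-homotopy after
    refinement; the fillings are those chosen for [E]. *)
Definition triangles_close E F : Prop :=
  forall x y z, E (x, y) -> E (x, z) -> E (z, y) ->
  homotopic F (x :: filling E x y) (x :: filling E x z ++ filling E z y).

Lemma refine_tail_cat E x s t : refine_tail E x (s ++ t) =
  refine_tail E x s ++ refine_tail E (last x s) t.
Proof. by elim: s x => //= y s IH x; rewrite IH catA. Qed.

Lemma eps_entourage_refl x : B (x, x).
Proof. by rewrite /B /eps_entourage /= mdistxx. Qed.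

Lemma eps_entourage_sym x y : B (x, y) -> B (y, x).
Proof. by rewrite /B /eps_entourage /= metric_sym. Qed.

Lemma path_eps_entourage E x s : B `<=` E ->
  path (erel B) x s -> path (erel E) x s.
Proof.
by move=> BE; apply: sub_path => y z; rewrite /erel !inE; exact: BE.
Qed.

Section Fillable.
Variable E : set (X * X).
Hypotheses (BE : B `<=` E) (fillE : fillable E).

Let Erefl x : E (x, x). Proof. exact/BE/eps_entourage_refl. Qed.

Lemma fillingP x y : erel E x y -> is_filling E x y (filling E x y).
Proof.
by rewrite /erel inE => /fillE xy; exact: (xgetPex [::] xy).
Qed.

Lemma refine_tail_last x s : path (erel E) x s ->
  last x (refine_tail E x s) = last x s.
Proof.
elim: s x => //= y s IH x /andP[/fillingP[_ xy _ _ _] /IH ys].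
by rewrite last_cat xy.
Qed.

Lemma refine_tail_path x s : path (erel E) x s ->
  path (erel B) x (refine_tail E x s).
Proof.
elim: s x => //= y s IH x /andP[/fillingP[cx xy _ _ _] /IH ys].
by rewrite cat_path cx xy.
Qed.

Lemma refine_tail_id x s : path (erel B) x s -> refine_tail E x s = s.
Proof.
elim: s x => //= y s IH x /andP[xy /IH ->].
have exy : erel E x y by apply/mem_set/BE/set_mem.
by have [_ _ _ _ ->] := fillingP exy; rewrite ?(set_mem xy).
Qed.

Lemma homotopic_refine_tail x s : path (erel E) x s ->
  homotopic E (x :: refine_tail E x s) (x :: s).
Proof.
elim: s x => [x _|y s IH x /= /andP[exy cs]]; first exact: rst_refl.
have [cx xy _ h _] := fillingP exy.
have cr : path (erel E) y (refine_tail E y s).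
  exact/(path_eps_entourage BE)/refine_tail_path.
apply: (@rst_trans _ _ _ (x :: [:: y] ++ refine_tail E y s)).
  apply: homotopic_catr => //.
  by rewrite cat_path xy cr (path_eps_entourage BE).
apply: (@homotopic_catl _ _ _ Erefl x [:: y]); last exact: IH.
by rewrite /= exy.
Qed.

Lemma homotopic_refine s : is_chain E s -> homotopic E (refine E s) s.
Proof. by case: s => [[]//|x s] /is_chainE; exact: homotopic_refine_tail. Qed.

Lemma refine_chain s : is_chain E s -> is_chain B (refine E s).
Proof.
by case: s => [[]//|x s] /is_chainE c; apply/is_chainE/refine_tail_path.
Qed.

Lemma refine_id s : is_chain B s -> refine E s = s.
Proof. by case: s => [[]//|x s] /is_chainE c /=; rewrite refine_tail_id. Qed.

Lemma refine_cat u x v : refine E (u ++ x :: v) =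
  refine E (rcons u x) ++ refine_tail E x v.
Proof.
case: u => [//|a u] /=; rewrite -cat_rcons refine_tail_cat last_rcons.
by [].
Qed.

Lemma refine_rcons_last u x : is_chain E (rcons u x) ->
  exists w, refine E (rcons u x) = rcons w x.
Proof.
case: u => [_|a u /is_chainE c]; first by exists [::].
rewrite /= lastI refine_tail_last // last_rcons.
by eexists.
Qed.

Variable F : set (X * X).
Hypothesis BF : B `<=` F.
Hypothesis triangleF : triangles_close E F.

Let Frefl x : F (x, x). Proof. exact/BF/eps_entourage_refl. Qed.

Lemma is_chain_eps s : is_chain B s -> is_chain F s.
Proof.
case: s => [[]//|x s] /is_chainE c.
exact/is_chainE/(path_eps_entourage BF).
Qed.

(** Refinement turns an insertion into replacing one side of a filled triangle by the other two, and
    [triangleF] closes that triangle in [F]. *)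
Lemma refine_homotopic s t : homotopic E s t ->
  homotopic F (refine E s) (refine E t).
Proof.
elim=> {s t} [_ _ [u x z y v cxy cxzy|x]|s|s t _ st|s t w _ st _ tw].
- have cF := is_chain_eps (refine_chain cxy); move: cF.
  move: cxy cxzy; rewrite !is_chain_cat /=.
  move=> [cu /andP[xy _]] [_ /and3P[xz zy _]].
  rewrite !refine_cat /= !catA -(catA _ (filling E x z)).
  (* The refined prefix still ends at [x], which lets the triangle based at [x] be glued in. *)
  have [|w ->] := @refine_rcons_last u x.
    by split => //; case: (u).
  rewrite -!catA !cat_rcons => cF.
  have := @homotopic_cat _ _ _ Frefl w (refine_tail E y v)
    _ _ (triangleF (set_mem xy) (set_mem xz) (set_mem zy)).
  by rewrite /= -!catA; apply.
- rewrite /= cats0.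
  have Bxx : erel B x x by exact/mem_set/eps_entourage_refl.
  have := @refine_tail_id x [:: x]; rewrite /= Bxx cats0 => -> //.
  by apply: rst_step; exact: homotopy_trivial.
- exact: rst_refl.
- exact: rst_sym.
- exact: rst_trans st tw.
Qed.

End Fillable.
End Refinement.

(** * The map of covers induced by refinement *)

Section CoverLift.
Context {R : realType} {X : metricType R} (x0 : X) (e : R) (m : nat).
Hypothesis e_gt0 : 0 < e.
Implicit Types (x y z : X) (s t u v : seq X).

Local Notation "\pi_[ E ] a" := (\pi_(cover_space x0 E)%qT a)
  (at level 10, a at next level).

Lemma cover_pi_eq (E : entourage_of X) (a b : based_chains x0 E) :
  \pi_[E] a = \pi_[E] b <-> homotopic E (val a) (val b).
Proof. by split=> [/eqmodP/asboolP//|h]; apply/eqmodP/asboolP. Qed.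

Lemma based_chainP (E : entourage_of X) s : reflect
  (exists2 t, s = x0 :: t & path (erel E) x0 t) (based_chain x0 E s).
Proof.
apply: (iffP (asboolP _)) => [[]|[t ->]]; last by move=> /is_chainE.
by case: s => [[]//|x s /is_chainE c /= xx0]; rewrite -xx0; exists s.
Qed.

Lemma based_chain1 (E : entourage_of X) : based_chain x0 E [:: x0].
Proof. by apply/based_chainP; exists [::]. Qed.

Definition trivial_chain (E : entourage_of X) : based_chains x0 E :=
  exist _ [:: x0] (based_chain1 E).

(** [insubd] only supplies a default; under the hypotheses of [cover_lift_pi] the refined chain is a
    based [F]-chain and its class does not depend on the representative. *)
Definition cover_lift (E F : entourage_of X) (p : cover_space x0 E) :
    cover_space x0 F :=
  \pi_[F] (insubd (trivial_chain F : {s | based_chain x0 F s})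
                  (refine e m E (val (repr p)))).

Section Lift.
Variables E F : entourage_of X.
Hypotheses (BE : eps_entourage e `<=` E) (BF : eps_entourage e `<=` F).
Hypothesis fillE : fillable e m E.
Hypothesis triangleF : triangles_close e m E F.

Let Erefl x : (E : set (X * X)) (x, x). Proof. exact/BE/eps_entourage_refl. Qed.
Let Frefl x : (F : set (X * X)) (x, x). Proof. exact/BF/eps_entourage_refl. Qed.
Let Esym x y : (E : set (X * X)) (x, y) -> (E : set (X * X)) (y, x).
Proof. exact: (entourage_setP E).1. Qed.
Let Fsym x y : (F : set (X * X)) (x, y) -> (F : set (X * X)) (y, x).
Proof. exact: (entourage_setP F).1. Qed.

Lemma cover_lift_pi (a : based_chains x0 E) : exists2 b : based_chains x0 F,
  val b = refine e m E (val a) & cover_lift F (\pi_[E] a) = \pi_[F] b.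
Proof.
have based (c : based_chains x0 E) : based_chain x0 F (refine e m E (val c)).
  have /based_chainP[t -> ct] := valP c.
  apply/based_chainP; exists (refine_tail e m E x0 t) => //.
  exact/(path_eps_entourage BF)/(refine_tail_path fillE).
exists (exist _ (refine e m E (val a)) (based a)) => //.
rewrite /cover_lift; apply/cover_pi_eq.
rewrite val_insubd based /=.
apply: (refine_homotopic e_gt0 BE fillE BF triangleF).
by apply/cover_pi_eq; rewrite reprK.
Qed.

Lemma cover_map_lift (p : cover_space x0 E) :
  cover_map (cover_lift F p) = cover_map p.
Proof.
rewrite -[p]reprK; have [b bE ->] := cover_lift_pi (repr p).
rewrite !cover_map_pi /chain_end bE.
have /based_chainP[t -> ct] := valP (repr p).
by rewrite /= refine_tail_last.
Qed.

(** A neighbour of the class of [s] is the class of [s] extended by one short step. Refinement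
    leaves that step unchanged, so the images are neighbours in the same way. *)
Lemma cover_lift_continuous : continuous (cover_lift F : cover_space x0 E -> _).
Proof.
apply/continuousP => U; rewrite !cover_openE => oU p /oU.
move=> [G [[_ [d d0 dG]] _ GU]].
have de0 : 0 < Num.min d e by rewrite lt_min d0.
have dle (xy : X * X) : eps_entourage (Num.min d e) xy ->
    mdist xy.1 xy.2 < d /\ mdist xy.1 xy.2 < e.
  by rewrite /eps_entourage /= lt_min => /andP.
(* [d] keeps the endpoints in [G]; [e] makes the filling of the pair of endpoints a single step. *)
exists (eps_entourage (Num.min d e)); split.
- exact: is_entourage_eps.
- by move=> xy /dle[_]; exact: BE.
move=> q [a [b [/= pa -> /dle[/= abd abe]]]] hab; apply: GU.
rewrite /= pa.
have [a' /= a'E ->] := cover_lift_pi a.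
have [b' /= b'E ->] := cover_lift_pi b.
exists a', b'; move: abd abe hab; rewrite /= /chain_end /= a'E b'E.
have /based_chainP[s /= -> cs] := valP a.
have /based_chainP[t /= -> ct] := valP b.
rewrite /concat_chain !rev_rtail /= !refine_tail_last // => abd abe hab.
split=> //; first exact: dG.
have exy : erel E (last x0 s) (last x0 t) by apply/mem_set/BE.
have crs := path_rtail Esym cs.
have tE : homotopic E (x0 :: t) (x0 :: rcons s (last x0 t)).
  apply: (@rst_trans _ _ _ (x0 :: s ++ rtail x0 s ++ t)).
    by apply: rst_sym; exact: homotopic_cat_rtail.
  rewrite -cats1; apply: homotopic_catl => //.
  by rewrite !cat_path cs crs last_rtail.
have tF := refine_homotopic e_gt0 BE fillE BF triangleF tE.
have fillxy : filling e m E (last x0 s) (last x0 t) = [:: last x0 t].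
  by have [_ _ _ _ ->] := fillingP fillE exy.
have crF : path (erel F) x0 (refine_tail e m E x0 s).
  exact/(path_eps_entourage BF)/(refine_tail_path fillE).
have ctF : path (erel F) x0 (refine_tail e m E x0 t).
  exact/(path_eps_entourage BF)/(refine_tail_path fillE).
move: tF; rewrite /= -cats1 refine_tail_cat /= fillxy /= => tF.
move: crF ctF tF; set s' := refine_tail _ _ _ _ s.
set t' := refine_tail _ _ _ _ t.
move=> crF ctF tF; have crF' := path_rtail Fsym crF.
have ls' : last x0 s' = last x0 s by rewrite refine_tail_last.
(* Prefix [tF] with the reversal of [s'], then cancel that reversal against [s']; one step
   remains. *)
have := @homotopic_catl _ _ _ Frefl (last x0 s') (rtail x0 s') t'
  (s' ++ [:: last x0 t]).
rewrite last_rtail cat_path crF' last_rtail => /(_ ctF tF).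
rewrite ls' => h; apply: (rst_trans _ _ _ _ _ h).
rewrite -ls'; have := @homotopic_cat_rtail _ _ _ Frefl Fsym (last x0 s')
  (rtail x0 s') [:: last x0 t] crF'.
by rewrite rtailK /= andbT; apply; rewrite ls'; apply/mem_set/BF.
Qed.

End Lift.

(** The first refinement already yields an [e]-chain, which the second leaves fixed; the round trip
    is therefore refinement in [E], and that preserves the [E]-class. *)
Lemma cover_liftK (E F : entourage_of X) :
  eps_entourage e `<=` E -> eps_entourage e `<=` F ->
  fillable e m E -> fillable e m F ->
  triangles_close e m E F -> triangles_close e m F E ->
  cancel (@cover_lift E F) (@cover_lift F E).
Proof.
move=> BE BF fE fF EF FE p; rewrite -[p]reprK.
have [b /= bE ->] := cover_lift_pi BE BF fE EF (repr p).
have [c /= cE ->] := cover_lift_pi BF BE fF FE b.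
apply/cover_pi_eq => /=; rewrite cE bE.
have /based_chainP[t /= -> /is_chainE ct] := valP (repr p).
have ch := refine_chain fE ct.
by rewrite (refine_id BF fF ch); exact: homotopic_refine.
Qed.

Lemma equivalent_covers_lift (E F : entourage_of X) :
  eps_entourage e `<=` E -> eps_entourage e `<=` F ->
  fillable e m E -> fillable e m F ->
  triangles_close e m E F -> triangles_close e m F E ->
  equivalent_covers x0 E F.
Proof.
move=> BE BF fE fF EF FE; exists (@cover_lift E F), (@cover_lift F E); split.
- exact: cover_liftK.
- exact: cover_liftK.
- exact: cover_lift_continuous.
- exact: cover_lift_continuous.
- exact: cover_map_lift.
Qed.

End CoverLift.

(** * Chained entourages admit short fillings *)

Section Fillings.
Context {R : realType} {X : metricType R}.
Implicit Types (E F : set (X * X)) (x y z : X) (s t u v : seq X).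

(** Every later point is [E]-related to [x], so the points just after [x] can be removed one by one
    until only the last is left. *)
Lemma homotopic_fan E x z s : (forall x, E (x, x)) ->
  (forall z', z' \in z :: s -> E (x, z')) -> path (erel E) z s ->
  homotopic E [:: x, z & s] [:: x; last z s].
Proof.
move=> Erefl; elim: s z => [z _ _|y s IH z xE /= /andP[zy cs]].
  exact: rst_refl.
have exz z' : z' \in [:: z, y & s] -> erel E x z' by move=> /xE /mem_set.
apply: (@rst_trans _ _ _ [:: x, y & s]); last first.
  by apply: IH => // z' z's; apply: xE; rewrite inE z's orbT.
apply: rst_sym; apply: (@homotopic_insert _ _ _ [::]) => //.
- by apply: exz; rewrite !inE eqxx orbT.
- by apply: exz; rewrite !inE eqxx.
- by apply/is_chainE; rewrite /= cs exz // !inE eqxx orbT.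
Qed.

Lemma chained_fillable (e : R) (N : seq X) E : 0 < e ->
  ball_cover (e / 2) N -> eps_entourage e `<=` E -> chained E ->
  fillable e (2 * size N) E.
Proof.
move=> e0 covN BE [_ chE] x y xy.
have Erefl z : E (z, z) by exact/BE/eps_entourage_refl.
have [xye|exy] := ltP (mdist x y) e.
  exists [:: y]; split=> //=.
  - by rewrite andbT; exact/mem_set.
  - by have [c] := covN x; case: N {covN} => //= *; lia.
  - exact: rst_refl.
have [s [/is_chainE cs sy sE]] := chE x y xy _ (is_entourage_eps e0).
have [t [ct ty tE tm]] := short_chain_in covN cs sy sE.
(* An empty tail would force [x] = [y], against [mdist x y] being at least [e]. *)
case: t ct ty tE tm => [_ xy' _ _|z t].
  by move: exy; rewrite -xy' /= mdistxx leNgt e0.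
move=> ct ty tE tm; exists (z :: t); split=> //.
- exact: ltnW.
- rewrite -ty; apply: homotopic_fan => //.
    by move=> z' z't; have [] : (eball x E `&` eball y E) z'
      by apply: tE; rewrite inE z't orbT.
  by have /andP[_] := path_eps_entourage BE ct.
- by rewrite ltNge exy.
Qed.

End Fillings.

(** * Moving chains to a finite net *)

Section Net.
Context {R : realType} {X : metricType R}.
Implicit Types (E F : set (X * X)) (x y z : X) (s t u v : seq X).
Variables (I : Type) (idx : X -> I) (mid : X -> X -> X).

(** Midpoints are recorded because net points e / 4 away from points less than e / 2 apart are less
    than [e] apart. The index of the starting point [x] is left out. *)
Fixpoint net_tail x s : seq I :=
  if s is y :: s' then [:: idx (mid x y), idx y & net_tail y s'] else [::].

Lemma size_net_tail x s : size (net_tail x s) = (2 * size s)%N.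
Proof. by elim: s x => //= y s IH x; rewrite IH; lia. Qed.

Lemma last_net_tail x s : last (idx x) (net_tail x s) = idx (last x s).
Proof. by elim: s x => //= y s IH x. Qed.

Variables (e : R) (c : I -> X).
Hypothesis e_gt0 : 0 < e.
Hypothesis idxP : forall x, mdist (c (idx x)) x < e / 4.
Hypothesis midP : forall x y, mdist x (mid x y) <= mdist x y / 2 /\
                              mdist (mid x y) y <= mdist x y / 2.
Let B : set (X * X) := eps_entourage e.

Section Homotopy.
Variable E : set (X * X).
Hypotheses (BE : B `<=` E) (Esym : forall x y, E (x, y) -> E (y, x)).

Let Erefl x : E (x, x). Proof. exact/BE/eps_entourage_refl. Qed.

Let close x y : mdist x y < e -> erel E x y.
Proof. by move=> xy; exact/mem_set/BE. Qed.

Let idxl x : erel E (c (idx x)) x.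
Proof. by apply: close; have := idxP x; move: e_gt0; lra. Qed.

Let idxr x : erel E x (c (idx x)).
Proof. by apply/mem_set/Esym/set_mem; exact: idxl. Qed.

Lemma homotopic_net_tail x s : path (erel B) x s -> homotopic E (x :: s)
  [:: x, c (idx x) & map c (net_tail x s) ++ [:: last x s]].
Proof.
elim: s x => [x _|y s IH x /= /andP[xy /[dup] cs /IH{}IH]].
  by apply: rst_sym; exact: homotopic_spur.
have cys := path_eps_entourage BE cs.
have {}xy : mdist x y < e by exact: (set_mem xy).
have xyE := close xy.
apply: (@rst_trans _ _ _
  (x :: [:: y] ++ c (idx y) :: map c (net_tail y s) ++ [:: last y s])).
  by apply: (@homotopic_catl _ _ _ Erefl x [:: y]) => //=; rewrite xyE.
move: (homotopic_path Erefl IH); rewrite cys => /esym /=.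
set t := _ ++ _ => /andP[_ ct].
have [xm my] := midP x y; have mc := idxP (mid x y).
have [[xc yc] e0] := (idxP x, idxP y, e_gt0).
have [] : mdist x (c (idx (mid x y))) < e /\ mdist (c (idx (mid x y))) y < e.
  have := metric_triangle x (mid x y) (c (idx (mid x y))).
  have := metric_triangle (c (idx (mid x y))) (mid x y) y.
  by rewrite (metric_sym (mid x y) (c _)); split; lra.
have [] : mdist (c (idx x)) (c (idx (mid x y))) < e /\
          mdist (c (idx (mid x y))) (c (idx y)) < e.
  have := metric_triangle (c (idx x)) x (c (idx (mid x y))).
  have := metric_triangle x (mid x y) (c (idx (mid x y))).
  have := metric_triangle (c (idx (mid x y))) (mid x y) (c (idx y)).
  have := metric_triangle (mid x y) y (c (idx y)).
  rewrite (metric_sym (mid x y) (c (idx (mid x y)))) (metric_sym y (c _)).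
  by split; lra.
set p := c (idx (mid x y)) => /close xp' /close py' /close xp /close py.
(* Three elementary moves: insert [p] between [x] and [y], insert the net point of [x] before [p],
   then remove [y]. *)
apply: (@rst_trans _ _ _ ([:: x, p, y, c (idx y) & t])).
  apply: (@homotopic_insert _ _ _ [::]) => //.
  by apply/is_chainE; rewrite /= xyE idxr.
apply: (@rst_trans _ _ _ ([:: x, c (idx x), p, y, c (idx y) & t])).
  apply: (@homotopic_insert _ _ _ [::]) => //.
  by apply/is_chainE; rewrite /= xp py idxr.
apply: rst_sym; apply: (@homotopic_insert _ _ _ [:: x; c (idx x)]) => //.
by apply/is_chainE; rewrite /= idxr xp' py'.
Qed.

(** By [homotopic_net_tail] the two loops are conjugate by the edge from [x] to its net point; each
    direction conjugates and removes the spur. *)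
Lemma net_nullP x s : path (erel B) x s -> last x s = x ->
  homotopic E (x :: s) [:: x] <->
  homotopic E (map c (idx x :: net_tail x s)) [:: c (idx x)].
Proof.
move=> cs sx; have h := homotopic_net_tail cs; rewrite sx in h.
have := homotopic_path Erefl h; rewrite (path_eps_entourage BE) // => /esym /=.
set t := map c _ => /andP[xc]; rewrite cat_path => /andP[ct /andP[tx _]].
have lt : last (c (idx x)) t = c (idx x) by rewrite last_map last_net_tail sx.
split=> [s0|t0].
  have h0 : homotopic E [:: x, c (idx x) & t ++ [:: x]] [:: x].
    exact: rst_trans (rst_sym _ _ _ _ h) s0.
  apply: (@rst_trans _ _ _ [:: c (idx x), x, c (idx x) & t]).
    by apply: rst_sym; exact: homotopic_spur.
  apply: (@rst_trans _ _ _
    ([:: c (idx x)] ++ [:: x, c (idx x) & t ++ [:: x]] ++ [:: c (idx x)])).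
    rewrite /= -catA -{1}[t]cats0.
    apply: (@homotopic_catl _ _ _ Erefl _ [:: x, c (idx x) & t]) => /=.
      by rewrite cats0 idxl xc ct.
    by rewrite lt; apply: rst_sym; exact: homotopic_spur.
  apply: (@rst_trans _ _ _ ([:: c (idx x)] ++ [:: x] ++ [:: c (idx x)])).
    apply: homotopic_cat => //; apply/is_chainE.
    by rewrite /= idxl xc -catA cat_path ct /= tx idxr.
  exact: homotopic_spur.
apply: (rst_trans _ _ _ _ _ h).
apply: (@rst_trans _ _ _ ([:: x] ++ [:: c (idx x)] ++ [:: x])).
  apply: (@homotopic_cat _ _ _ Erefl [:: x] [:: x] _ _ t0).
  by apply/is_chainE; rewrite /= xc cat_path ct /= tx.
exact: homotopic_spur.
Qed.

End Homotopy.
End Net.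

(** * Padding words to a common length *)

Section Padding.
Context {R : realType} {X : metricType R}.

Lemma homotopic_pad (E : set (X * X)) (x : X) (s : seq X) n :
  (forall x, E (x, x)) -> path (erel E) x s ->
  homotopic E (x :: s ++ nseq n (last x s)) (x :: s).
Proof.
move=> Erefl cs; rewrite -{3}[s]cats0.
have cn y : path (erel E) y (nseq n y).
  by elim: n => //= n ->; rewrite andbT; exact/mem_set.
apply: homotopic_catl => //; first by rewrite cat_path cs cn.
elim: n (last x s) cn => [|n IH] y cn; first exact: rst_refl.
have cn' z : path (erel E) z (nseq n z) by have /andP[] := cn z.
apply: rst_trans (IH y cn').
apply: rst_sym; apply: (@homotopic_stutter _ _ _ Erefl [::]).
exact/is_chainE.
Qed.

End Padding.

(** * Coding an entourage by its null words *)

Section Coding.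
Context {R : realType} {X : metricType R}.
Implicit Types (E F : set (X * X)) (x y z : X) (s t u v : seq X).
Variables (e : R) (m k L : nat) (c : 'I_k -> X) (idx : X -> 'I_k).
Variable mid : X -> X -> X.
Hypothesis e_gt0 : 0 < e.
Hypothesis idxP : forall x, mdist (c (idx x)) x < e / 4.
Hypothesis midP : forall x y, mdist x (mid x y) <= mdist x y / 2 /\
                              mdist (mid x y) y <= mdist x y / 2.
Hypothesis mL : (6 * m < L)%N.
Let B : set (X * X) := eps_entourage e.

(** [take 1] gives the one-point chain at the first letter, so loops at all net points are recorded
    together. *)
Definition null_loops E : {set L.-tuple 'I_k} :=
  [set u : L.-tuple 'I_k |
    `[< homotopic E (map c u) (take 1 (map c u)) >]]%SET.

Lemma null_loops_transfer (E F : entourage_of X) x s :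
  B `<=` E -> B `<=` F -> null_loops E = null_loops F ->
  path (erel B) x s -> last x s = x -> (size s <= 3 * m)%N ->
  homotopic E (x :: s) [:: x] -> homotopic F (x :: s) [:: x].
Proof.
move=> BE BF EF cs sx sm.
have Esym := (entourage_setP E).1; have Fsym := (entourage_setP F).1.
have Erefl x' : (E : set (X * X)) (x', x') by exact/BE/eps_entourage_refl.
have Frefl x' : (F : set (X * X)) (x', x') by exact/BF/eps_entourage_refl.
pose t := net_tail idx mid x s.
(* The unpadded word has 2 * [size s] + 1 letters, at most 6 * [m] + 1, which [mL] bounds by [L]. *)
have tL : size (idx x :: t ++ nseq (L - (size t).+1) (idx x)) == L.
  by rewrite /= size_cat size_nseq size_net_tail; lia.
have tupE (G : entourage_of X) : B `<=` G ->
    (Tuple tL \in null_loops G) <-> homotopic G (x :: s) [:: x].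
  move=> BG; have Gsym := (entourage_setP G).1.
  have Grefl x' : (G : set (X * X)) (x', x') by exact/BG/eps_entourage_refl.
  have lt : last (c (idx x)) (map c t) = c (idx x).
    by rewrite last_map last_net_tail sx.
  have ct : path (erel G) (c (idx x)) (map c t).
    have := homotopic_path Grefl
      (homotopic_net_tail e_gt0 idxP midP BG Gsym cs).
    rewrite (path_eps_entourage BG) // => /esym /= /andP[_].
    by rewrite cat_path => /andP[].
  have := homotopic_pad (L - (size t).+1) Grefl ct; rewrite lt => pad.
  rewrite (net_nullP e_gt0 idxP midP BG Gsym cs sx) inE.
  rewrite /= take0 map_cat map_nseq -/t.
  split=> [/asboolP h|h]; last by apply/asboolP; exact: rst_trans pad h.
  exact: rst_trans (rst_sym _ _ _ _ pad) h.
by move=> /(tupE E BE); rewrite EF => /(tupE F BF).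
Qed.

(** Both sides of the triangle refine [E]-homotopic chains, so together they bound an [E]-null loop
    of at most 3 * [m] steps; the code carries its nullity over to [F]. *)
Lemma null_loops_triangles (E F : entourage_of X) :
  B `<=` E -> B `<=` F -> fillable e m E -> null_loops E = null_loops F ->
  triangles_close e m E F.
Proof.
move=> BE BF fE EF x y z /mem_set xy /mem_set xz /mem_set zy.
have Esym := (entourage_setP E).1; have Fsym := (entourage_setP F).1.
have Erefl x' : (E : set (X * X)) (x', x') by exact/BE/eps_entourage_refl.
have Frefl x' : (F : set (X * X)) (x', x') by exact/BF/eps_entourage_refl.
have [cxy lxy mxy _ _] := fillingP fE xy.
have [cxz lxz mxz _ _] := fillingP fE xz.
have [czy lzy mzy _ _] := fillingP fE zy.
have h : homotopic E (x :: filling e m E x z ++ filling e m E z y)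
                     (x :: filling e m E x y).
  have -> : filling e m E x z ++ filling e m E z y =
      refine_tail e m E x [:: z; y].
    by rewrite /= cats0.
  have -> : filling e m E x y = refine_tail e m E x [:: y] by rewrite /= cats0.
  have cxzy : path (erel E) x [:: z; y] by rewrite /= /erel xz zy.
  have cxy1 : path (erel E) x [:: y] by rewrite /= /erel xy.
  apply: (rst_trans _ _ _ _ _ (homotopic_refine_tail e_gt0 BE fE cxzy)).
  apply: rst_sym.
  apply: (rst_trans _ _ _ _ _ (homotopic_refine_tail e_gt0 BE fE cxy1)).
  by apply: (@homotopic_insert _ _ _ [::]) => //; apply/is_chainE.
move: cxy cxz czy lxy lxz lzy mxy mxz mzy h.
move: (filling _ _ _ x y) (filling _ _ _ x z) (filling _ _ _ z y) => w a b.
move=> cw ca cb lw la lb mw ma mb h.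
have cab : path (erel B) x (a ++ b) by rewrite cat_path ca la.
have lab : last x (a ++ b) = last x w by rewrite last_cat la lb lw.
apply/rst_sym/(homotopic_nullP Frefl Fsym) => //.
- exact: path_eps_entourage cab.
- exact: path_eps_entourage cw.
have cl : path (erel B) x ((a ++ b) ++ rtail x w).
  rewrite cat_path cab lab /=; apply: path_rtail => // ? ?.
  exact: eps_entourage_sym.
have ll : last x ((a ++ b) ++ rtail x w) = x.
  by rewrite last_cat lab last_rtail.
have ml : (size ((a ++ b) ++ rtail x w) <= 3 * m)%N.
  by rewrite !size_cat size_rtail; lia.
apply: (null_loops_transfer BE BF EF cl ll ml).
apply/(homotopic_nullP Erefl Esym) => //.
- exact: path_eps_entourage cab.
- exact: path_eps_entourage cw.
Qed.

End Coding.

(** * Equivalence classes of covers and the count *)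

Section Classification.
Context {R : realType} {X : metricType R} (x0 : X).
Implicit Types E F G : entourage_of X.

Lemma equivalent_covers_sym E F :
  equivalent_covers x0 E F -> equivalent_covers x0 F E.
Proof.
move=> [h [k [hK kK hc kc hm]]]; exists k, h; split=> // p.
by rewrite -hm kK.
Qed.

Lemma equivalent_covers_trans E F G :
  equivalent_covers x0 E F -> equivalent_covers x0 F G ->
  equivalent_covers x0 E G.
Proof.
move=> [h [k [hK kK hc kc hm]]] [h' [k' [hK' kK' hc' kc' hm']]].
exists (h' \o h), (k \o k'); split.
- exact: can_comp.
- exact: can_comp.
- by move=> p; apply: continuous_comp; [exact: hc|exact: hc'].
- by move=> p; apply: continuous_comp; [exact: kc'|exact: kc].
- by move=> p /=; rewrite hm' hm.
Qed.

Lemma eq_cover_class E F : equivalent_covers x0 E F ->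
  cover_class x0 E = cover_class x0 F.
Proof.
move=> EF; apply/seteqP; split=> G [chG] h; split=> //.
  exact: equivalent_covers_trans (equivalent_covers_sym EF) h.
exact: equivalent_covers_trans EF h.
Qed.

(** The supremum need not be attained, but a distance strictly below [e] lies below some admissible
    radius. *)
Lemma eps_entourage_sub_sigma (e : R) (E : set (X * X)) :
  (e%:E <= sigma E)%E -> eps_entourage e `<=` E.
Proof.
move=> eE [x y] /= xye.
have : ((mdist x y)%:E < sigma E)%E by apply: lt_le_trans eE; rewrite lte_fin.
by move=> /ereal_sup_gt[_ [d [_ dE] <-]]; rewrite lte_fin; exact: (dE (x, y)).
Qed.

End Classification.

Theorem theorem1 (R : realType) (X : metricType R) (x0 : X)
    (compactX : compact [set: X]) (geodesicX : geodesic_space X)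
    (eps : R) (eps_gt0 : 0 < eps) :
  cover_classes x0 eps #<=
    `I_(2 ^ (covering_number X (eps / 4)
             ^ (40 * covering_number X (eps / 2)))).
Proof.
have [||N2 N2E cov2] := @covering_numberP _ X (eps / 2).
- exact: compactX.
- by rewrite divr_gt0.
have [||N4 N4E cov4] := @covering_numberP _ X (eps / 4).
- exact: compactX.
- by rewrite divr_gt0.
rewrite -N2E -N4E.
(* Positivity makes 12 * [size N2] strictly smaller than 40 * [size N2]. *)
have N20 : (0 < size N2)%N by have [c] := cov2 x0; case: (N2).
have /choice[idx idxP] : forall z, exists k : 'I_(size N4),
    mdist (nth x0 N4 k) z < eps / 4.
  move=> z; have [c cN] := cov4 z; rewrite ballEmdist => cz.
  have kN : (index c N4 < size N4)%N by rewrite index_mem.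
  by exists (Ordinal kN); rewrite /= nth_index.
have /choice[mid midP] : forall p : X * X, exists z,
    mdist p.1 z <= mdist p.1 p.2 / 2 /\ mdist z p.2 <= mdist p.1 p.2 / 2.
  by move=> p; exact: geodesic_midpoint.
pose L := (40 * size N2)%N.
pose code E := null_loops L (fun i : 'I_(size N4) => nth x0 N4 i) E.
pose D : set (entourage_of X) :=
  [set E : entourage_of X | chained E /\ (eps%:E <= sigma E)%E].
have codeP (E F : entourage_of X) : D E -> D F -> code E = code F ->
    equivalent_covers x0 E F.
  move=> [chE /eps_entourage_sub_sigma BE] [chF /eps_entourage_sub_sigma BF] EF.
  have fE := chained_fillable eps_gt0 cov2 BE chE.
  have fF := chained_fillable eps_gt0 cov2 BF chF.
  have mL : (6 * (2 * size N2) < L)%N by rewrite /L; lia.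
  have mid2 x y := midP (x, y).
  apply: (equivalent_covers_lift x0 eps_gt0 BE BF fE fF).
    exact: (null_loops_triangles eps_gt0 idxP mid2 mL BE BF fE EF).
  exact: (null_loops_triangles eps_gt0 idxP mid2 mL BF BE fF (esym EF)).
pose num E : nat := enum_rank (code E).
(* The union of all classes with code number [n]; by [codeP] these classes coincide, so [G] recovers
   a class from its number without a choice of entourage. *)
pose G n := [set F | exists E : entourage_of X,
  [/\ D E, num E = n & cover_class x0 E F]].
have GE E : D E -> cover_class x0 E = G (num E).
  move=> DE; apply/seteqP; split=> F; first by exists E.
  move=> [E' [DE' /ord_inj/enum_rank_inj E'E]].
  by rewrite (eq_cover_class (codeP _ _ DE' DE E'E)).
have sub : cover_classes x0 eps `<=` G @` `I_(2 ^ (size N4 ^ L)).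
  move=> _ [E DE <-]; rewrite (GE _ DE); exists (num E) => //=.
  (* A code is a subset of the words of length [L] over the net, hence 2 to the power of the number
     of words. *)
  have := ltn_ord (enum_rank (code E)).
  rewrite -[X in (_ < X)%N]cardsT -powersetT card_powerset cardsT.
  by rewrite card_tuple card_ord.
exact: card_le_trans (subset_card_le sub) (card_image_le _ _).
Qed.
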